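(* Let $F(x,t)$ be a family of polynomials of the ''first kind'' with coefficients in $A$, that is, $$F(x,t)=x^2A_{n-2}(x)+B_n(x)t+O(t^2),$$ where $A_{n-2},B_n\in A[x]$, the subscripts denote the degree of an expression, $A_{n-2}(0)B_n(0)\ne0$ and $A_{n-2}(x)$ is square-free. Then $$\operatorname{Ver}(F)=-4B_n(0)A_{n-2}^3(0).$$
   Context: $k$ is an algebraically closed field of characteristic zero, $A$ is a $k$-algebra and integral domain, $K=\operatorname{Frac}(A)$ and $\overline K$ is an algebraic closure of $K$. Family of polynomials of degree $n$ with coefficients in $A$: $F(x,t)=\sum_{i\ge0}F_i(x)t^i$ with $F_i\in A[x]$, $\deg F_0=n$, $\deg F_i\le n$ for $i>0$. View $F$ as a polynomial in $x$ of degree $n$ over $A[[t]]$ with leading coefficient $u(t)$. The $t$-roots of $F$ are its $n$ roots in $\bigcup_N\overline K((t^{1/N}))$; they lie in $\bigcup_N\overline K[[t^{1/N}]]$, and their constant terms are the roots of $F_0$. For a nonzero Puiseux series $g$ in $t$, $g_0$ is the coefficient of its lowest power of $t$. For $h=a_p\prod_{i=1}^p(x-\alpha_i)$ and $g$ of degree $m$, $\operatorname{Res}(h,g)=a_p^m\prod_ig(\alpha_i)$. Vertex: for $F_0=\prod_\nu f_\nu^{n_\nu}$ with $f_\nu$ coprime having roots $a_{\nu\ell}$, $\operatorname{Ver}(F):=\prod_{\nu,\ell}\Delta(F,f_\nu)(a_{\nu\ell},t)_0\prod_{\nu<\nu'}\operatorname{Res}(f_\nu,f_{\nu'})^{2(n_\nu+n_{\nu'}-n_\nu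 n_{\nu'})}$, where $\Delta(F,f_\nu)$ is the generalized formal discriminant: writing $F=Q\prod_{i=1}^{n_\nu}(f_\nu-s_i'(x,t))$ with $Q$ collecting $u(t)$ and the factors $(x-s)$ for the $t$-roots $s$ with $f_\nu(s(0))\neq0$, $\Delta(F,f_\nu)(x,t)$ is the discriminant in $w$ of $Q\prod_i(w-s_i')$, namely $Q^{2n_\nu-2}\prod_{i<j}(s_i'-s_j')^2$. Here the factorization used is $f_1=x$, $n_1=2$ and $f_2=A_{n-2}$, $n_2=1$. Since $n_2=1$, $\Delta(F,f_2)=1$. If $s_1,s_2$ are the two $t$-roots with constant term $0$ and $s_3,\dots,s_n$ the others, then $\Delta(F,x)(0,t)=\big[u(t)\prod_{j\ge3}(-s_j)\big]^{2}(s_1-s_2)^2$. Hence $\operatorname{Ver}(F)=\Delta(F,x)(0,t)_0\cdot\operatorname{Res}(x,A_{n-2})^{2(2+1-2)}$. *)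

(* Defs.v *)
From HB Require Import structures.
From mathcomp Require Import all_boot all_order all_algebra.
From mathcomp Require Import mathcomp_extra boolp classical_sets fsbigop.
From mathcomp Require Import ring lra.

Set Implicit Arguments.
Unset Strict Implicit.
Unset Printing Implicit Defensive.

Import Order.TTheory GRing.Theory Num.Theory.

Local Open Scope classical_set_scope.
Local Open Scope ring_scope.

(* The union over N > 0 of the fields of Laurent series in t^(1/N) with
   coefficients in L: a series is its coefficient function rat -> L, whose
   support lies in {(i - M) / N : i in nat} for some M and some N > 0. *)
Section PuiseuxSeries.
Variable L : fieldType.
Implicit Types f g h : rat -> L.

Definition grid (N M i : nat) : rat := (i%:R - M%:R) / N%:R.

Definition supported_on (N M : nat) f :=
  forall q, f q != 0 -> exists i, q = grid N M i.

Definition is_puiseux f := exists N M, (0 < N)%N /\ supported_on N M f.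

Record puiseux := Puiseux {
  pcoef :> rat -> L;
  puiseuxP : is_puiseux pcoef }.

HB.instance Definition _ := gen_eqMixin puiseux.
HB.instance Definition _ := gen_choiceMixin puiseux.

Lemma puiseux_eq (f g : puiseux) : pcoef f =1 pcoef g -> f = g.
Proof.
case: f g => f fP [g gP] /= /funext fg; case: _ / fg gP => gP.
by rewrite (Prop_irrelevance fP gP).
Qed.

Lemma supported_onW N M k M' f : (0 < N)%N -> (0 < k)%N -> (M * k <= M')%N ->
  supported_on N M f -> supported_on (N * k) M' f.
Proof.
move=> N0 k0 MM' fP q /fP [i ->]; exists (i * k + (M' - M * k))%N.
rewrite /grid natrD natrB// !natrM.
have N0' : N%:R != 0 :> rat by rewrite pnatr_eq0 -lt0n.
have k0' : k%:R != 0 :> rat by rewrite pnatr_eq0 -lt0n.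
by field; rewrite N0' k0'.
Qed.

Lemma is_puiseux3 f g h : is_puiseux f -> is_puiseux g -> is_puiseux h ->
  exists N M, [/\ (0 < N)%N, supported_on N M f, supported_on N M g
                & supported_on N M h].
Proof.
move=> [N1 [M1 [n1 f1]]] [N2 [M2 [n2 f2]]] [N3 [M3 [n3 f3]]].
set M := (M1 * (N2 * N3) + M2 * (N1 * N3) + M3 * (N1 * N2))%N.
exists (N1 * (N2 * N3))%N, M; split.
- by rewrite !muln_gt0 n1 n2 n3.
- by apply: supported_onW f1 => //; rewrite ?muln_gt0 ?n2 // /M -addnA leq_addr.
- rewrite mulnCA; apply: supported_onW f2; rewrite ?muln_gt0 ?n1 //.
  by rewrite /M addnAC leq_addl.
- rewrite mulnA mulnC; apply: supported_onW f3; rewrite ?muln_gt0 ?n1 //.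
  by rewrite /M leq_addl.
Qed.

Lemma is_puiseux0 : is_puiseux (fun=> 0).
Proof. by exists 1%N, 0%N; split => // q; rewrite eqxx. Qed.

Lemma is_puiseuxN f : is_puiseux f -> is_puiseux (fun q => - f q).
Proof.
move=> [N [M [N0 fP]]]; exists N, M; split => // q.
by rewrite oppr_eq0 => /fP.
Qed.

Lemma is_puiseuxD f g :
  is_puiseux f -> is_puiseux g -> is_puiseux (fun q => f q + g q).
Proof.
move=> fP gP; have [N [M [N0 fP' gP' _]]] := is_puiseux3 fP gP gP.
exists N, M; split => // q fgq.
have [f0|/fP'//] := eqVneq (f q) 0; apply: gP'.
by move: fgq; rewrite f0 add0r.
Qed.

Definition pzero := Puiseux is_puiseux0.
Definition popp (f : puiseux) := Puiseux (is_puiseuxN (puiseuxP f)).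
Definition padd (f g : puiseux) :=
  Puiseux (is_puiseuxD (puiseuxP f) (puiseuxP g)).

Lemma paddA : associative padd.
Proof. by move=> f g h; apply: puiseux_eq => q /=; rewrite addrA. Qed.
Lemma paddC : commutative padd.
Proof. by move=> f g; apply: puiseux_eq => q /=; rewrite addrC. Qed.
Lemma padd0 : left_id pzero padd.
Proof. by move=> f; apply: puiseux_eq => q /=; rewrite add0r. Qed.
Lemma paddN : left_inverse pzero popp padd.
Proof. by move=> f; apply: puiseux_eq => q /=; rewrite addNr. Qed.

HB.instance Definition _ := Algebra.isZmodule.Build puiseux paddA paddC padd0 paddN.

(* The sum is finitely supported when f and g satisfy [is_puiseux]. *)
Definition conv f g (c : rat) : L := \sum_(a \in [set: rat]) (f a * g (c - a)).

Lemma grid_inj N M : (0 < N)%N -> injective (grid N M).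
Proof.
move=> N0 i j /eqP; rewrite /grid.
have N0' : N%:R != 0 :> rat by rewrite pnatr_eq0 -lt0n.
by rewrite (inj_eq (mulIf (invr_neq0 N0'))) (inj_eq (addIr _)) eqr_nat => /eqP.
Qed.

Lemma convE N M n f g c : (0 < N)%N -> supported_on N M f ->
  supported_on N M g -> c * N%:R + M%:R + M%:R < n%:R ->
  conv f g c = \sum_(i < n) f (grid N M i) * g (c - grid N M i).
Proof.
move=> N0 fP gP cn; rewrite /conv.
have N0' : N%:R != 0 :> rat by rewrite pnatr_eq0 -lt0n.
transitivity (\sum_(a <- [seq grid N M i | i <- iota 0 n]) (f a * g (c - a))).
  apply/esym; rewrite fsbig_seq; last first.
    by rewrite map_inj_uniq ?iota_uniq//; apply: grid_inj.
  apply: fsbig_widen => // a /= [_ anr].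
  have [->|/fP [i ai]] := eqVneq (f a) 0; first by rewrite mul0r.
  have [->|/gP [j gj]] := eqVneq (g (c - a)) 0; first by rewrite mulr0.
  exfalso; apply: anr; apply/mapP; exists i => //.
  rewrite mem_iota /= add0n -(ltr_nat rat); apply: le_lt_trans cn.
  have -> : c = grid N M i + grid N M j by rewrite -gj ai addrC subrK.
  have -> : (grid N M i + grid N M j) * N%:R + M%:R + M%:R
            = i%:R + j%:R :> rat by rewrite /grid; field.
  by rewrite lerDl ler0n.
by rewrite big_map -[in LHS](subn0 n) -/(index_iota 0 n) big_mkord.
Qed.

Lemma convC f g : conv f g = conv g f.
Proof.
apply/funext => c; rewrite /conv (reindex_fsbigT (fun a => c - a)); last first.
  by exists (fun a => c - a) => a; rewrite opprB addrC subrK.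
by apply: eq_fsbigr => a _; rewrite mulrC opprB [c + _]addrC subrK.
Qed.

Lemma bound_exists (x : rat) : exists n : nat, x < n%:R.
Proof.
by exists (Num.truncn x).+1; apply: truncnS_gt.
Qed.

Lemma convDl f g h : is_puiseux f -> is_puiseux g -> is_puiseux h ->
  conv (fun q => f q + g q) h = (fun q => conv f h q + conv g h q).
Proof.
move=> fP gP hP; have [N [M [N0 {}fP {}gP {}hP]]] := is_puiseux3 fP gP hP.
apply/funext => c; have [n cn] := bound_exists (c * N%:R + M%:R + M%:R).
have fgP : supported_on N M (fun q => f q + g q).
  move=> q; have [->|/fP//] := eqVneq (f q) 0.
  by rewrite add0r => /gP.
rewrite !(convE N0 _ _ cn)// -big_split; apply: eq_bigr => i _.
by rewrite mulrDl.
Qed.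

Lemma supported_conv N M f g : (0 < N)%N ->
  supported_on N M f -> supported_on N M g ->
  supported_on N (M + M) (conv f g).
Proof.
move=> N0 fP gP c; have [n cn] := bound_exists (c * N%:R + M%:R + M%:R).
have N0' : N%:R != 0 :> rat by rewrite pnatr_eq0 -lt0n.
rewrite (convE N0 fP gP cn) => S0.
have [[i /eqP]|all0] := pselect (exists i : 'I_n,
    f (grid N M i) * g (c - grid N M i) <> 0); last first.
  move: S0; rewrite big1 ?eqxx// => i _; apply: contrapT => i0.
  by case: all0; exists i.
rewrite mulf_eq0 negb_or => /andP[_ /gP [j cj]].
exists (i + j)%N; rewrite -(subrK (grid N M i) c) cj /grid !natrD.
by field.
Qed.

Lemma is_puiseux_conv f g :
  is_puiseux f -> is_puiseux g -> is_puiseux (conv f g).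
Proof.
move=> fP gP; have [N [M [N0 {}fP {}gP _]]] := is_puiseux3 fP gP gP.
by exists N, (M + M)%N; split => //; apply: supported_conv.
Qed.

Lemma convCA f g h : is_puiseux f -> is_puiseux g -> is_puiseux h ->
  conv f (conv g h) = conv g (conv f h).
Proof.
move=> fP gP hP; have [N [M [N0 {}fP {}gP {}hP]]] := is_puiseux3 fP gP hP.
apply/funext => c; pose M2 := (M + M)%N.
have N0' : 0 < N%:R :> rat by rewrite ltr0n.
have W k : supported_on N M k -> supported_on N M2 k.
  by move=> kP; rewrite -[N]muln1; apply: supported_onW kP => //; rewrite muln1 leq_addr.
have [n cn] := bound_exists (c * N%:R + M2%:R + M2%:R + M2%:R).
have M0 : 0 <= M2%:R :> rat by rewrite ler0n.
have c1 : c * N%:R + M2%:R + M2%:R < n%:R by lra.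
have c2 i : (c - grid N M2 i) * N%:R + M2%:R + M2%:R < n%:R.
  have -> : (c - grid N M2 i) * N%:R = c * N%:R + M2%:R - i%:R.
    by rewrite /grid; field; rewrite gt_eqF.
  have : 0 <= i%:R :> rat by rewrite ler0n.
  lra.
rewrite !(convE N0 _ _ c1); try by [apply: W | apply: supported_conv].
have E (f' g' : rat -> L) : supported_on N M f' -> supported_on N M g' ->
    \sum_(i < n) f' (grid N M2 i) * conv g' h (c - grid N M2 i) =
    \sum_(i < n) \sum_(j < n) f' (grid N M2 i) * (g' (grid N M2 j)
       * h (c - grid N M2 i - grid N M2 j)).
  move=> fP' gP'; apply: eq_bigr => i _.
  by rewrite (convE N0 (W _ gP') (W _ hP) (c2 i)) mulr_sumr.
rewrite !E// exchange_big; apply: eq_bigr => i _; apply: eq_bigr => j _.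
by rewrite mulrCA addrAC.
Qed.

Lemma is_puiseux_series (a : nat -> L) : is_puiseux
  (fun q => if q \is a Num.nat then a (Num.truncn q) else 0).
Proof.
exists 1%N, 0%N; split => // q; case: ifP => [/natrP [i ->] _|_ /eqP//].
by exists i; rewrite /grid subr0 divr1.
Qed.

(* \sum_i a_i t^i *)
Definition of_series (a : nat -> L) : puiseux := Puiseux (is_puiseux_series a).

Definition pconst (a : L) : puiseux := of_series (fun i => if i is 0 then a else 0).

Definition pmul (f g : puiseux) : puiseux :=
  Puiseux (is_puiseux_conv (puiseuxP f) (puiseuxP g)).

Lemma pmulC : commutative pmul.
Proof. by move=> f g; apply: puiseux_eq => q /=; rewrite convC. Qed.

Lemma pmulA : associative pmul.
Proof.
move=> f g h; apply: puiseux_eq => q /=.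
rewrite [conv g h]convC convCA; try exact: puiseuxP.
by rewrite convC.
Qed.

Lemma pconstE a q : pconst a q = if q == 0 then a else 0.
Proof.
rewrite /=; case: ifP => [/natrP [i ->]|qn].
  by rewrite natrK pnatr_eq0; case: i.
by case: eqP => // q0; rewrite q0 rpred0 in qn.
Qed.

Lemma pmul1 : left_id (pconst 1) pmul.
Proof.
move=> f; apply: puiseux_eq => c; rewrite -[LHS]/(conv (pconst 1) f c) /conv.
rewrite -(fsbig_widen [set 0]) ?fsbig_set1//.
  by rewrite pconstE eqxx mul1r subr0.
move=> a [_ /eqP/negbTE a0]; change (pconst 1 a * f (c - a) = 0).
by rewrite pconstE a0 mul0r.
Qed.

Lemma pmulDl : left_distributive pmul padd.
Proof.
by move=> f g h; apply: puiseux_eq => q /=; rewrite convDl//; apply: puiseuxP.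
Qed.

Lemma pone_neq0 : pconst 1 != 0.
Proof.
apply/eqP => /(congr1 (fun f : puiseux => f 0)); rewrite pconstE eqxx.
by move/eqP; rewrite oner_eq0.
Qed.

HB.instance Definition _ := GRing.Zmodule_isComNzRing.Build puiseux
  pmulA pmulC pmul1 pmulDl pone_neq0.

(* The coefficient g_0 of the lowest power of t occurring in g (g != 0). *)
Definition lowest_exp (g : puiseux) : rat :=
  xget 0 [set q | g q != 0 /\ forall r, r < q -> g r = 0].

Definition lowest_coef (g : puiseux) : L := g (lowest_exp g).

End PuiseuxSeries.

Definition square_free (k : fieldType) (p : {poly k}) :=
  forall q : {poly k}, q ^+ 2 %| p -> (size q <= 1)%N.

(* F = \sum_i F_i(x) t^i is given by the sequence i |-> F_i. *)
Definition is_family (R : nzRingType) (n : nat) (F : nat -> {poly R}) :=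
  size (F 0%N) = n.+1 /\ forall i, (size (F i) <= n.+1)%N.

Definition first_kind (R : idomainType) (n : nat) (F : nat -> {poly R})
    (A B : {poly R}) :=
  [/\ (2 <= n)%N, is_family n F,
      F 0%N = 'X^2 * A /\ F 1%N = B,
      size A = n.-1 /\ size B = n.+1 &
      A.[0] * B.[0] != 0 /\ square_free (map_poly (@FracField.tofrac R) A)].

Section Vertex.
Variable L : closedFieldType.
Local Notation P := (puiseux L).

Definition roots_of (f : {poly L}) : seq L := sval (closed_field_poly_normal f).

Definition Res (h g : {poly L}) : L :=
  lead_coef h ^+ (size g).-1 * \prod_(a <- roots_of h) g.[a].

(* F as a polynomial in x over the Puiseux series in t; its leading
   coefficient is u(t). *)
Definition family_poly (n : nat) (F : nat -> {poly L}) : {poly P} :=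
  \poly_(j < n.+1) of_series (fun i => (F i)`_j).

Definition t_roots (F : {poly P}) : seq P :=
  xget [::] [set s | F = lead_coef F *: \prod_(z <- s) ('X - z%:P)].

Definition lift_poly (f : {poly L}) : {poly P} := map_poly (@pconst L) f.

(* Q(x,t); the scalar lc(f)^(-m), equal to 1 when f is monic, makes
   Q * \prod_(i < m) (f - s'_i) have the same leading coefficient as F. *)
Definition disc_cofactor (F : {poly P}) (f : {poly L}) (m : nat) : {poly P} :=
  (pconst (lead_coef f ^- m) * lead_coef F) *:
    \prod_(s <- t_roots F | f.[s 0] != 0) ('X - s%:P).

(* The f - s'_i deform f: deg_x s'_i < deg f and s'_i(x,0) = 0.  For f = 'X
   this forces the s'_i to be the t-roots with constant term 0; for deg f > 1
   it fixes them only up to the way the t-roots are distributed. *)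
Definition is_disc_roots (F : {poly P}) (f : {poly L}) (m : nat)
    (s' : seq {poly P}) :=
  [/\ size s' = m,
      F = disc_cofactor F f m * \prod_(p <- s') (lift_poly f - p) &
      forall p, p \in s' -> (size p < size f)%N /\ forall j, p`_j 0 = 0].

Definition disc_roots (F : {poly P}) (f : {poly L}) (m : nat) : seq {poly P} :=
  xget [::] [set s' | is_disc_roots F f m s'].

(* The generalized formal discriminant Delta(F, f), for f a factor of
   multiplicity m of F_0. *)
Definition formal_disc (F : {poly P}) (f : {poly L}) (m : nat) : {poly P} :=
  let s' := disc_roots F f m in
  disc_cofactor F f m ^+ (2 * m - 2) *
  \prod_(i < m) \prod_(j < m | (i < j)%N) (s'`_i - s'`_j) ^+ 2.

(* Ver(F) for the factorization F_0 = \prod_v f_v ^ n_v listed by fs, where the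
   f_v are meant to be pairwise coprime and square-free; a rescaling of the f_v
   changes the value. The exponent of the resultants may be negative. *)
Definition vertex (n : nat) (F : nat -> {poly L}) (fs : seq ({poly L} * nat)) : L :=
  let f i := (nth (1, 0%N) fs i).1 in
  let m i := (nth (1, 0%N) fs i).2 in
  let Fp := family_poly n F in
  (\prod_(i < size fs) \prod_(a <- roots_of (f i))
      lowest_coef (formal_disc Fp (f i) (m i)).[pconst a]) *
  (\prod_(i < size fs) \prod_(j < size fs | (i < j)%N)
      Res (f i) (f j) ^ (2 * ((m i)%:Z + (m j)%:Z - (m i)%:Z * (m j)%:Z))).

End Vertex.

(* R -> Frac(R) -> L *)
Definition frac_embed (R : idomainType) (L : nzRingType)
    (iota : {rmorphism {fraction R} -> L}) (a : R) : L :=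
  iota (FracField.tofrac a).

(* Ver(F) for a family F over R and a factorization fs of F_0 over R. *)
Definition Ver (R : idomainType) (L : closedFieldType)
    (iota : {rmorphism {fraction R} -> L}) (n : nat) (F : nat -> {poly R})
    (fs : seq ({poly R} * nat)) : L :=
  vertex n (fun i => map_poly (frac_embed iota) (F i))
           [seq (map_poly (frac_embed iota) f.1, f.2) | f <- fs].

(* Main.v *)
(* The lowest coefficient of the discriminant is read off the t-roots.
   Hensel's lemma lifts each root of A_{n-2} to a t-root in Kbar[[t]], and lifts
   the two square roots +-b of -B_n(0)/A_{n-2}(0) to roots y of
   F(t^(1/2) y, t)/t, which gives s_1, s_2 = +-b t^(1/2) + ...; since A_{n-2} is
   square-free these are n distinct t-roots, hence all of them. The cofactor
   u(t) prod_{j>=3} (-s_j) has constant term A_{n-2}(0), so Delta(F,x)(0,t)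
   starts with (A_{n-2}(0) * 2 b)^2 t = -4 A_{n-2}(0) B_n(0) t. *)
Require Import Defs.
From HB Require Import structures.
From mathcomp Require Import all_boot all_order all_algebra separable.
From mathcomp Require Import boolp classical_sets fsbigop.
From mathcomp Require Import ring lra.

Import Order.TTheory GRing.Theory Num.Theory.
Local Open Scope ring_scope.

Set Implicit Arguments.
Unset Strict Implicit.
Unset Printing Implicit Defensive.

(** * Order in t and lowest coefficients of Puiseux series *)

Section Valuation.
Variable L : fieldType.
Local Notation P := (puiseux L).
Implicit Types (f g h : P) (q r s : rat).

Lemma coef_addp f g q : (f + g) q = f q + g q.
Proof. by []. Qed.

(** A lower bound for the order in t, stated on coefficients so that the zero series, which
    satisfies every bound, is not a separate case. *)
Definition order_ge r f := forall q, q < r -> f q = 0.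

Lemma order_ge_le {r s f} : r <= s -> order_ge s f -> order_ge r f.
Proof. by move=> rs fs q qr; apply/fs/(lt_le_trans qr). Qed.

Lemma order_geD {r f g} : order_ge r f -> order_ge r g -> order_ge r (f + g).
Proof. by move=> fr gr q qr; rewrite /= fr// gr// addr0. Qed.

Lemma order_geN {r f} : order_ge r f -> order_ge r (- f).
Proof. by move=> fr q qr; rewrite /= fr// oppr0. Qed.

Lemma order_geM {r s f g} :
  order_ge r f -> order_ge s g -> order_ge (r + s) (f * g).
Proof.
move=> fr gs c crs; apply: fsbig1 => a _.
have [/fr->|ra] := ltP a r; first by rewrite mul0r.
by rewrite gs ?mulr0//; lra.
Qed.

(** Only the term [a = r] of the convolution survives: below [r] the factor [f a] vanishes, and
    above it the exponent left for [g] drops below [s]. *)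
Lemma coef_mulp_lowest {r s f g} : order_ge r f -> order_ge s g ->
  (f * g) (r + s) = f r * g s.
Proof.
move=> fr gs.
rewrite -[LHS]/(conv f g (r + s)) /conv -(fsbig_widen [set r]%classic)//.
  by rewrite fsbig_set1 addrC addKr.
move=> a [_ /eqP ar] /=.
have [/fr->|ra] := ltP a r; first by rewrite mul0r.
by rewrite gs ?mulr0// ltrBlDl ltrD2r lt_neqAle ra eq_sym ar.
Qed.

(** The support lies on a grid indexed by natural numbers, so a least index with a nonzero
    coefficient exists. *)
Lemma puiseux_neq0 f : f != 0 -> exists2 r, f r != 0 & order_ge r f.
Proof.
move=> f0; have [N [M [N0 fP]]] := puiseuxP f.
have ex : exists i, f (grid N M i) != 0.
  apply: contrapT => /forallNP nf; case/negP: f0; apply/eqP.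
  apply: puiseux_eq => q /=; apply/eqP/negPn/negP => fq.
  by have [i qi] := fP _ fq; apply: (nf i); rewrite -qi.
case: (ex_minnP ex) => m fm min_m; exists (grid N M m) => // q qm.
apply/eqP/negPn/negP => fq; have [i qi] := fP _ fq.
move: qm; rewrite qi ltNge => /negP; apply.
by rewrite ler_wpM2r ?invr_ge0// lerD2r ler_nat min_m// -qi.
Qed.

Lemma lowest_coefE r f : f r != 0 -> order_ge r f -> lowest_coef f = f r.
Proof.
move=> fr f_r; rewrite /lowest_coef /lowest_exp (@xget_unique _ _ _ r)//.
move=> q [fq f_q]; have [qr|rq|//] := ltgtP q r.
  by rewrite f_r ?eqxx in fq.
by rewrite f_q ?eqxx in fr.
Qed.

Lemma puiseux_mulf_eq0 f g : f * g = 0 -> (f == 0) || (g == 0).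
Proof.
move=> fg0; apply: contrapT => /negP; rewrite negb_or => /andP[f0 g0].
have [r fr f_r] := puiseux_neq0 f0; have [s gs g_s] := puiseux_neq0 g0.
have /eqP := coef_mulp_lowest f_r g_s.
by rewrite fg0 /= eq_sym mulf_eq0 (negbTE fr) (negbTE gs).
Qed.

(** Units and inverses are obtained by choice: they serve to equip [P] with the unit ring structure
    on which the integral domain structure is built. *)
Definition puiseux_unit : {pred P} := fun f => `[< exists g, g * f = 1 >].

Definition puiseux_inv f : P :=
  if f \in puiseux_unit then xget 0 [set g | g * f = 1]%classic else f.

Lemma puiseux_mulVf : {in puiseux_unit, left_inverse 1 puiseux_inv *%R}.
Proof.
move=> f fU; rewrite /puiseux_inv fU; have /asboolP ex := fU.
exact: (xgetPex 0 ex).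
Qed.

Lemma puiseux_unitPl f g : g * f = 1 -> puiseux_unit f.
Proof. by move=> gf; apply/asboolP; exists g. Qed.

Lemma puiseux_inv_out : {in [predC puiseux_unit], puiseux_inv =1 id}.
Proof. by move=> f /negbTE fU; rewrite /puiseux_inv fU. Qed.

HB.instance Definition _ := GRing.ComNzRing_hasMulInverse.Build P
  puiseux_mulVf puiseux_unitPl puiseux_inv_out.
HB.instance Definition _ := GRing.ComUnitRing_isIntegral.Build P puiseux_mulf_eq0.

(** * The monomials t^q and multiplication by them *)

Lemma is_puiseux_monomial q : is_puiseux (fun r => (r == q)%:R : L).
Proof.
exists `|denq q|%N, `|numq q|%N; split => [|r]; first by rewrite absz_gt0 denq_neq0.
case: (r =P q) => [-> _|_ /eqP//].
(* The grid starts at -|numq q| / denq q, so q itself has index numq q + |numq q|, which is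
   nonnegative even for negative q. *)
exists `|(numq q + `|numq q|)%R|%N.
have num0 : 0 <= numq q + `|numq q|.
  by rewrite -lerBlDl sub0r -normrN ler_norm.
rewrite /grid !pmulrn (gez0_abs num0) (gez0_abs (denq_ge0 q)) abszE.
by rewrite intrD addrK divq_num_den.
Qed.

Definition monomial q : P := Puiseux (is_puiseux_monomial q).

Lemma coef_monomialM q f r : (monomial q * f) r = f (r - q).
Proof.
rewrite -[LHS]/(conv (monomial q) f r) /conv -(fsbig_widen [set q]%classic)//.
  by rewrite fsbig_set1 /= eqxx mul1r.
by move=> a [_ /eqP/negbTE aq] /=; rewrite aq mul0r.
Qed.

Lemma monomialD q r : monomial (q + r) = monomial q * monomial r.
Proof.
by apply: puiseux_eq => s; rewrite coef_monomialM /= subr_eq addrC.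
Qed.

Lemma monomial0 : monomial 0 = 1.
Proof. by apply: puiseux_eq => s; rewrite -[RHS]/(pconst 1 s) pconstE /=; case: eqP. Qed.

Lemma monomialX q i : monomial q ^+ i = monomial (q *+ i).
Proof.
by elim: i => [|i IH]; rewrite ?expr0 ?monomial0// exprS mulrS monomialD IH.
Qed.

Lemma order_ge_monomialM q f r :
  order_ge r f -> order_ge (q + r) (monomial q * f).
Proof. by move=> fr s sr; rewrite coef_monomialM fr//; lra. Qed.

Lemma coef_pconstM a f r : (pconst a * f) r = a * f r.
Proof.
rewrite -[LHS]/(conv (pconst a) f r) /conv -(fsbig_widen [set 0]%classic)//.
  by rewrite fsbig_set1 [_ 0]pconstE eqxx subr0.
by move=> b [_ /eqP/negbTE b0]; rewrite /preimage/mkset [X in X * _]pconstE b0 mul0r.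
Qed.

Lemma coef_psum (I : Type) (s : seq I) (p : pred I) (E : I -> P) r :
  (\sum_(i <- s | p i) E i) r = \sum_(i <- s | p i) E i r.
Proof. by apply: (big_morph (fun f : P => f r)). Qed.

(** * Power series in t^(1/(N+1)) and their reduction at t = 0 *)

Variable N : nat.

(* The power series in t^(1/(N+1)). *)
Definition pseries : {pred P} := fun f => `[< supported_on N.+1 0 f >].

Lemma pseriesP f : reflect (supported_on N.+1 0 f) (f \in pseries).
Proof. exact: asboolP. Qed.

Lemma pseries_subring : subring_closed pseries.
Proof.
split.
- apply/pseriesP => q; rewrite -[(1 : P) q]/(pconst 1 q) pconstE.
  case: (q =P 0) => [-> _|_ /eqP//]; exists 0%N.
  by rewrite /grid subr0 mul0r.
- move=> f g /pseriesP fS /pseriesP gS; apply/pseriesP => q /=.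
  have [->|/fS//] := eqVneq (f q) 0.
  by rewrite add0r oppr_eq0 => /gS.
- by move=> f g /pseriesP fS /pseriesP gS; apply/pseriesP/(supported_conv _ fS gS).
Qed.

HB.instance Definition _ := GRing.isSubringClosed.Build P pseries pseries_subring.

Lemma order_ge_pseries f : f \in pseries -> order_ge 0 f.
Proof.
move=> /pseriesP fS q q0; apply/eqP/negPn/negP => /fS [i qi].
by move: q0; rewrite qi ltNge /grid subr0 divr_ge0.
Qed.

Lemma pconst_pseries a : pconst a \in pseries.
Proof.
apply/pseriesP => q; rewrite pconstE; case: (q =P 0) => [-> _|_ /eqP//].
by exists 0%N; rewrite /grid subr0 mul0r.
Qed.

Lemma monomial_pseries i : monomial (i%:R / N.+1%:R) \in pseries.
Proof.
apply/pseriesP => q /=; case: (q =P _) => [-> _|_ /eqP//].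
by exists i; rewrite /grid subr0.
Qed.

(** Exponents are multiples of 1/(N+1), so one more vanishing coefficient raises the order by a
    whole step. *)
Lemma order_ge_pseriesS f i : f \in pseries ->
  order_ge (i%:R / N.+1%:R) f -> f (i%:R / N.+1%:R) = 0 ->
  order_ge (i.+1%:R / N.+1%:R) f.
Proof.
move=> /pseriesP fS fi f0 q qi; apply/eqP/negPn/negP => fq.
have [j qj] := fS _ fq; move: qi; rewrite qj /grid subr0 ltr_pM2r ?invr_gt0//.
rewrite ltr_nat ltnS leq_eqVlt => /orP[/eqP ji|ji].
  by rewrite qj ji /grid subr0 f0 eqxx in fq.
by rewrite fi ?eqxx// qj /grid subr0 ltr_pM2r ?invr_gt0// ltr_nat in fq.
Qed.

Lemma const_coef_pseriesM f g : f \in pseries -> g \in pseries ->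
  (f * g) 0 = f 0 * g 0.
Proof.
move=> /order_ge_pseries fS /order_ge_pseries gS.
by rewrite -[in LHS](addr0 0) (coef_mulp_lowest fS gS).
Qed.

Lemma const_coef_pseriesX f i : f \in pseries -> (f ^+ i) 0 = f 0 ^+ i.
Proof.
move=> fS; elim: i => [|i IH].
  by rewrite !expr0 -[LHS]/(pconst 1 0) pconstE eqxx.
by rewrite !exprS const_coef_pseriesM ?rpredX// IH.
Qed.

Lemma const_coef_pseries_prod (I : eqType) (s : seq I) (E : I -> P) :
  {in s, forall i, E i \in pseries} ->
  (\prod_(i <- s) E i) 0 = \prod_(i <- s) E i 0.
Proof.
elim: s => [|i s IH] ES.
  by rewrite !big_nil -[LHS]/(pconst 1 0) pconstE eqxx.
have sS : {in s, forall i, E i \in pseries}.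
  by move=> j js; rewrite ES// inE js orbT.
rewrite !big_cons const_coef_pseriesM ?IH ?ES ?mem_head//.
by rewrite big_seq rpred_prod.
Qed.

Definition const_coef f : L := f 0.

Lemma coef_map_const_coef (G : {poly P}) i : (map_poly const_coef G)`_i = G`_i 0.
Proof. by rewrite coef_map_id0. Qed.

(** Taking the constant term is multiplicative on series without negative exponents, hence commutes
    with evaluation. *)
Lemma horner_const_coef (G : {poly P}) x : G \is a polyOver pseries ->
  x \in pseries -> G.[x] 0 = (map_poly const_coef G).[x 0].
Proof.
move=> /polyOverP GS xS; rewrite horner_coef coef_psum.
rewrite (horner_coef_wide _ (size_poly _ _)).
apply: eq_bigr => i _.
by rewrite const_coef_pseriesM ?rpredX// const_coef_pseriesX// coef_map_const_coef.
Qed.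

Lemma deriv_map_const_coef (G : {poly P}) :
  (map_poly const_coef G)^`() = map_poly const_coef G^`().
Proof.
apply/polyP => i; rewrite coef_deriv !coef_map_const_coef coef_deriv.
by move: G`_i.+1 => f; elim: i.+1 => [|j IH]; rewrite ?mulr0n// !mulrS /= -IH.
Qed.

(** Taylor expansion to second order; what matters is that the remainder [w] is again a power
    series, so that its product with [h ^+ 2] has at least twice the order of [h]. *)
Lemma horner_pseries_taylor (G : {poly P}) x h : G \is a polyOver pseries ->
  x \in pseries -> h \in pseries -> exists2 w, w \in pseries &
  G.[x + h] = G.[x] + G^`().[x] * h + w * h ^+ 2.
Proof.
move=> + xS hS; elim/poly_ind: G => [|G c IH] GS.
  by exists 0; rewrite ?rpred0// deriv0 !horner0 !mul0r !addr0.
have GS' : G \is a polyOver pseries.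
  apply/polyOverP => i; have /polyOverP/(_ i.+1) := GS.
  by rewrite coefD coefMX coefC /= addr0.
have [w wS e] := IH GS'.
(* This remainder for [G * 'X + c] comes from multiplying the expansion of [G] by [x + h] and
   collecting the multiples of [h ^+ 2]. *)
exists (w * (x + h) + G^`().[x]).
  by rewrite rpredD ?rpredM ?rpredD ?rpred_horner ?polyOver_deriv.
by rewrite derivMXaddC !hornerMXaddC hornerD hornerMX e; ring.
Qed.

End Valuation.

(** * Hensel's lemma: lifting a simple root of the reduction *)

Section Hensel.
Variables (L : fieldType) (N : nat) (G : {poly puiseux L}) (a : L).
Local Notation P := (puiseux L).
Hypothesis GS : G \is a polyOver (pseries N).
Hypothesis Ga : root (map_poly (@const_coef L) G) a.
Hypothesis G'a : (map_poly (@const_coef L) G)^`().[a] != 0.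

Local Notation expo i := (i%:R / N.+1%:R : rat).

(** A Newton correction limited to one monomial, with the derivative replaced by its constant term:
    to first order it cancels the coefficient of index [i] in [G.[x]]. *)
Definition hensel_step (x : P) (i : nat) : P :=
  pconst (- (G.[x] (expo i)) / (map_poly (@const_coef L) G)^`().[a]) * monomial L (expo i).

Fixpoint hensel_approx (m : nat) : P :=
  if m is m'.+1 then hensel_approx m' + hensel_step (hensel_approx m') m
  else pconst a.

Lemma coef_hensel_step x i q :
  hensel_step x i q = (- (G.[x] (expo i)) / (map_poly (@const_coef L) G)^`().[a])
                        * (q == expo i)%:R.
Proof. by rewrite coef_pconstM. Qed.

Lemma hensel_step_order x i : order_ge (expo i) (hensel_step x i).
Proof. by move=> q qi; rewrite coef_hensel_step lt_eqF// mulr0. Qed.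

Lemma hensel_step_pseries x i : hensel_step x i \in pseries N.
Proof. by rewrite rpredM ?pconst_pseries ?monomial_pseries. Qed.

Lemma hensel_approx_pseries m : hensel_approx m \in pseries N.
Proof.
by elim: m => [|m IH]; rewrite ?pconst_pseries//= rpredD ?hensel_step_pseries.
Qed.

Lemma hensel_approx0 m : hensel_approx m 0 = a.
Proof.
elim: m => [|m IH]; first by rewrite /hensel_approx pconstE eqxx.
by rewrite coef_addp IH hensel_step_order ?addr0// divr_gt0.
Qed.

(** Each correction keeps the order already reached and removes the next coefficient, so the order
    grows by one step of 1/(N+1). *)
Lemma hensel_approx_order m : order_ge (expo m.+1) G.[hensel_approx m].
Proof.
have GxS j : G.[hensel_approx j] \in pseries N.
  by rewrite rpred_horner ?hensel_approx_pseries.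
elim: m => [|m IH].
  apply: order_ge_pseriesS => //; first by rewrite mul0r; apply/(order_ge_pseries (N := N)).
  by rewrite mul0r (horner_const_coef GS) ?hensel_approx_pseries// hensel_approx0 (eqP Ga).
set x := hensel_approx m in IH *; set h := hensel_step x m.+1.
have xS : x \in pseries N by apply: hensel_approx_pseries.
have hS : h \in pseries N by apply: hensel_step_pseries.
have ho : order_ge (expo m.+1) h by apply: hensel_step_order.
have G'S := polyOver_deriv GS.
have G'xS : G^`().[x] \in pseries N by rewrite rpred_horner.
have e0 : 0 < expo m.+1 by rewrite divr_gt0.
rewrite -[hensel_approx _]/(x + h); apply: order_ge_pseriesS.
- by rewrite rpred_horner// rpredD.
- have [w wS ->] := horner_pseries_taylor GS xS hS.
  apply: order_geD; first apply: order_geD => //.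
    rewrite -[expo _]add0r; apply: order_geM => //; exact: (order_ge_pseries (N := N)).
  rewrite -[expo _]add0r; apply: order_geM; first exact: (order_ge_pseries (N := N)).
  by apply: order_ge_le (order_geM ho ho); rewrite lerDl ltW.
- have [w wS ->] := horner_pseries_taylor GS xS hS.
  have w0 := order_ge_pseries wS.
  rewrite expr2 !coef_addp (order_geM w0 (order_geM ho ho)); last by rewrite add0r ltrDl.
  rewrite addr0 -{2}[expo _]add0r (coef_mulp_lowest (order_ge_pseries G'xS) ho).
  rewrite (horner_const_coef G'S)// -deriv_map_const_coef hensel_approx0.
  by rewrite coef_hensel_step eqxx mulr1 [X in _ + X]mulrC divfK// subrr.
Qed.

Lemma hensel_approx_stable m m' q : (m <= m')%N -> q < expo m.+1 ->
  hensel_approx m' q = hensel_approx m q.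
Proof.
move=> + qm; elim: m' => [|m' IH]; first by rewrite leqn0 => /eqP->.
rewrite leq_eqVlt => /orP[/eqP->//|mm'].
rewrite coef_addp IH// hensel_step_order ?addr0//; apply: lt_le_trans qm _.
by rewrite ler_wpM2r ?invr_ge0// ler_nat.
Qed.

(** The index from which the coefficient at [q] of the approximations no longer changes; for
    negative [q] truncation gives 0. *)
Let height (q : rat) := Num.truncn (q * N.+1%:R).

Let height_lt q : q < expo (height q).+1.
Proof. by rewrite ltr_pdivlMr ?ltr0n// truncnS_gt. Qed.

Let limit q := hensel_approx (height q) q.

Let limit_supported : supported_on N.+1 0 limit.
Proof. by move=> q; apply/pseriesP/hensel_approx_pseries. Qed.

(** The root is the coefficientwise limit of the approximations, which differs from the [m]-th one
    only from exponent [expo m.+1] on. *)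
Lemma hensel : exists2 x : P, x \in pseries N & x 0 = a /\ root G x.
Proof.
have limP : is_puiseux limit by exists N.+1, 0%N.
pose x := Puiseux limP.
have xS : x \in pseries N by apply/pseriesP.
have xm m : order_ge (expo m.+1) (x - hensel_approx m).
  move=> q qm /=; apply/eqP; rewrite subr_eq0 /limit.
  have [mq|qm'] := leqP m (height q).
    by rewrite (hensel_approx_stable mq).
  by rewrite -(hensel_approx_stable (ltnW qm')) ?height_lt.
exists x => //; split; first exact: hensel_approx0.
apply/eqP/puiseux_eq => q.
(* With this [m], all three terms of the Taylor expansion at [hensel_approx m] have order beyond
   [q]. *)
set m := height q; have qm := height_lt q.
have ySm := hensel_approx_pseries m.
have hS : x - hensel_approx m \in pseries N by rewrite rpredB.
have [w wS] := horner_pseries_taylor GS ySm hS.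
have G'y : G^`().[hensel_approx m] \in pseries N.
  by rewrite rpred_horner ?polyOver_deriv.
rewrite addrC subrK expr2 => ->; rewrite !coef_addp hensel_approx_order// add0r.
have e0 : 0 < expo m.+1 by rewrite divr_gt0.
have h2 : order_ge (expo m.+1) ((x - hensel_approx m) * (x - hensel_approx m)).
  by apply: order_ge_le (order_geM (xm m) (xm m)); rewrite lerDl ltW.
rewrite (order_geM (order_ge_pseries G'y) (xm m)) ?add0r//.
by rewrite (order_geM (order_ge_pseries wS) h2) ?add0r.
Qed.

End Hensel.

(** * Splitting of polynomials over an integral domain *)

Section Factorization.
Variable R : idomainType.
Implicit Types (p : {poly R}) (rs : seq R).

(* [all_roots_prod_XsubC] asks for the differences of the roots to be units. *)
Lemma idomain_all_roots p rs : uniq rs -> all (root p) rs ->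
  size p = (size rs).+1 -> p = lead_coef p *: \prod_(z <- rs) ('X - z%:P).
Proof.
move=> rs_uniq p_rs p_size.
have [q pq] : exists q, p = q * \prod_(z <- rs) ('X - z%:P).
  elim: rs rs_uniq p_rs {p_size} => [|z rs IH] /=.
    by exists p; rewrite big_nil mulr1.
  move=> /andP[zrs rs_uniq] /andP[pz /(IH rs_uniq)[q pq]].
  move: pz; rewrite pq rootM root_prod_XsubC (negbTE zrs) orbF.
  by move=> /factor_theorem[q' ->]; exists q'; rewrite big_cons mulrA.
have p0 : p != 0 by rewrite -size_poly_eq0 p_size.
have q0 : q != 0 by apply: contraNneq p0 => q0; rewrite pq q0 mul0r.
have : size q = 1%N.
  move: p_size; rewrite pq size_Mmonic ?monic_prod_XsubC// size_prod_XsubC.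
  by rewrite addnS /= -add1n => /addIn.
move=> /eqP/size_poly1P[c _ qc].
by rewrite pq lead_coef_Mmonic ?monic_prod_XsubC// qc lead_coefC mul_polyC.
Qed.

(** Both lists have the same elements and the same length; as [rs] has no repetition, neither has
    [rs']. *)
Lemma perm_eq_split_roots p rs rs' : p != 0 -> uniq rs ->
  p = lead_coef p *: \prod_(z <- rs) ('X - z%:P) ->
  p = lead_coef p *: \prod_(z <- rs') ('X - z%:P) -> perm_eq rs rs'.
Proof.
move=> p0 rs_uniq prs prs'; have lp0 : lead_coef p != 0 by rewrite lead_coef_eq0.
have eq_prod := etrans (esym prs) prs'.
have mem z : (z \in rs) = (z \in rs').
  have /(congr1 (fun q => root q z)) := eq_prod.
  by rewrite /= !rootZ// !root_prod_XsubC.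
have eq_size : size rs = size rs'.
  have /(congr1 (fun q : {poly R} => size q)) := eq_prod.
  by rewrite /= !size_scale// !size_prod_XsubC => -[].
apply: uniq_perm => //; rewrite (leq_size_uniq rs_uniq) ?eq_size// => z.
by rewrite mem.
Qed.

End Factorization.

(** * Coefficients of series with natural exponents *)

Section OfSeries.
Variable L : fieldType.
Local Notation P := (puiseux L).

Lemma coef_of_series (a : nat -> L) i : of_series a i%:R = a i.
Proof. by rewrite /= rpred_nat natrK. Qed.

Lemma of_series_supported (a : nat -> L) q :
  of_series a q != 0 -> exists2 i, q = i%:R & a i != 0.
Proof.
rewrite /=; case: ifP => [/natrP[i ->]|_ /eqP//].
by rewrite natrK => ai; exists i.
Qed.

Lemma of_series_pseries (a : nat -> L) : of_series a \in pseries 0.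
Proof.
apply/pseriesP => q /of_series_supported[i -> _]; exists i.
by rewrite /grid subr0 divr1.
Qed.

End OfSeries.

(** * The t-roots of a family of the first kind *)

Section FirstKind.
Variables (L : closedFieldType) (n : nat) (F : nat -> {poly L}) (A B : {poly L}).
Local Notation P := (puiseux L).
Hypothesis two_neq0 : 2%:R != 0 :> L.
Hypothesis F_family : is_family n F.
Hypothesis F0E : F 0%N = 'X^2 * A.
Hypothesis F1E : F 1%N = B.
Hypothesis A0 : A.[0] != 0.
Hypothesis B0 : B.[0] != 0.
Hypothesis A_sep : separable_poly A.

Local Notation Fp := (family_poly n F).

Let F0_size : size (F 0%N) = n.+1. Proof. by case: F_family. Qed.

Let A_neq0 : A != 0.
Proof. by apply: contraNneq A0 => ->; rewrite horner0. Qed.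

Let A_size : n.+1 = (size A + 2)%N.
Proof.
by rewrite -F0_size F0E mulrC size_Mmonic ?monicXn// size_polyXn addnS.
Qed.

Lemma coef_family_poly j : Fp`_j = of_series (fun i => (F i)`_j).
Proof.
rewrite coef_poly; case: ltnP => // nj; apply/esym/puiseux_eq => q.
apply/eqP/negPn/negP => /of_series_supported[i _ /negP]; apply.
by rewrite nth_default// (leq_trans _ nj)//; case: F_family.
Qed.

Lemma coef_family_poly_nat j i : Fp`_j i%:R = (F i)`_j.
Proof. by rewrite coef_family_poly coef_of_series. Qed.

Lemma family_poly_supported j q :
  Fp`_j q != 0 -> exists2 i, q = i%:R & (F i)`_j != 0.
Proof. by rewrite coef_family_poly => /of_series_supported. Qed.

Lemma const_coef_family_poly : map_poly (@const_coef L) Fp = F 0%N.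
Proof.
by apply/polyP => j; rewrite coef_map_const_coef (coef_family_poly_nat _ 0).
Qed.

Lemma family_poly_pseries : Fp \is a polyOver (pseries 0).
Proof. by apply/polyOverP => j; rewrite coef_family_poly of_series_pseries. Qed.

Let Fpn_neq0 : Fp`_n 0 != 0.
Proof.
rewrite (coef_family_poly_nat _ 0).
have := F0_size; rewrite -[n]/(n.+1.-1) => <-; rewrite -lead_coefE lead_coef_eq0.
by rewrite -size_poly_eq0 F0_size.
Qed.

Lemma size_family_poly : size Fp = n.+1.
Proof.
apply/anti_leq; rewrite size_poly/= ltnNge; apply/negP => /leq_sizeP/(_ n (leqnn n)) e.
by move: Fpn_neq0; rewrite e eqxx.
Qed.

Lemma const_coef_lead_family_poly : (lead_coef Fp) 0 = lead_coef A.
Proof.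
rewrite lead_coefE size_family_poly (coef_family_poly_nat _ 0).
have := F0_size; rewrite -[n]/(n.+1.-1) => <-; rewrite -lead_coefE F0E.
by rewrite mulrC lead_coef_Mmonic ?monicXn.
Qed.

Let A_roots : A = lead_coef A *: \prod_(a <- roots_of A) ('X - a%:P).
Proof. exact: svalP (closed_field_poly_normal A). Qed.

Let lead_A_neq0 : lead_coef A != 0. Proof. by rewrite lead_coef_eq0. Qed.

Lemma mem_roots_of_A a : (a \in roots_of A) = root A a.
Proof. by rewrite [in RHS]A_roots rootZ// root_prod_XsubC. Qed.

Lemma uniq_roots_of_A : uniq (roots_of A).
Proof.
rewrite -separable_prod_XsubC; apply: dvdp_separable A_sep.
by rewrite [X in _ %| X]A_roots dvdpZr// dvdpp.
Qed.

Lemma size_roots_of_A : (size (roots_of A)).+2 = n.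
Proof.
apply: succn_inj; rewrite A_size [in RHS]A_roots size_scale// size_prod_XsubC.
by rewrite addn2.
Qed.

(** A root of [A] is nonzero and simple, hence a simple root of [F 0 = 'X^2 * A], and Hensel's lemma
    applies with N + 1 = 1. *)
Lemma unramified_root a : a \in roots_of A ->
  exists x : P, [/\ x \in pseries 0, x 0 = a & root Fp x].
Proof.
rewrite mem_roots_of_A => Aa.
have a0 : a != 0 by apply: contraTneq Aa => ->.
have [q Aq] := factor_theorem _ _ Aa.
have qa : ~~ root q a by move: A_sep; rewrite Aq separable_root => /andP[].
have [||x xS [xa xr]] := @hensel L 0 Fp a family_poly_pseries.
- by rewrite const_coef_family_poly F0E rootM Aa orbT.
(* Writing [A = q * ('X - a)], the derivative of [F 0] at [a] is a^2 q(a). *)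
- rewrite const_coef_family_poly F0E Aq mulrA derivM derivXsubC mulr1 hornerD.
  by rewrite hornerM hornerXsubC subrr mulr0 add0r hornerM hornerXn mulf_neq0 ?expf_neq0.
by exists x.
Qed.

(* The Newton polygon of [Fp] at the double root [0] of [F 0] has slope -1/2:
   this is Fp(t^(1/2) y) / t. *)
Definition ramified_poly : {poly P} :=
  \poly_(j < n.+1) (monomial L (j%:R / 2%:R - 1) * Fp`_j).

Lemma horner_ramified_poly y :
  Fp.[monomial L (1 / 2%:R) * y] = monomial L 1 * ramified_poly.[y].
Proof.
rewrite (horner_coef_wide _ (size_poly _ _)) (horner_coef_wide _ (size_poly _ _)).
rewrite mulr_sumr; apply: eq_bigr => j _; rewrite [in RHS]coef_poly ltn_ord.
have -> : j%:R / 2%:R - 1 = (1 / 2%:R) *+ j - 1 :> rat by rewrite -mulr_natr; field.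
by rewrite exprMn monomialX !mulrA -monomialD [Fp`_j * _]mulrC addrC subrK.
Qed.

Lemma coef_ramified_poly j q : ramified_poly`_j q = Fp`_j (q - j%:R / 2%:R + 1).
Proof.
have [jn|nj] := ltnP j n.+1.
  by rewrite coef_poly jn coef_monomialM opprB addrA addrAC.
by rewrite !nth_default ?size_poly// (leq_trans (size_poly _ _)).
Qed.

Let F0_coef j : (F 0%N)`_j = if (j < 2)%N then 0 else A`_(j - 2).
Proof. by rewrite F0E coefXnM. Qed.

(** The exponents are i + j/2 - 1, that is (2i + j - 2)/2. A negative one would need i = 0 and j <
    2, where [F 0 = 'X^2 * A] has no coefficient. *)
Lemma ramified_poly_pseries : ramified_poly \is a polyOver (pseries 1).
Proof.
apply/polyOverP => j; apply/pseriesP => q.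
rewrite coef_ramified_poly => /family_poly_supported[i qi Fij].
have ij : (2 <= 2 * i + j)%N.
  case: i {qi} Fij => [|i _]; last by rewrite mulnS -addnA leq_addr.
  by rewrite F0_coef; case: ltnP => //; rewrite eqxx.
exists (2 * i + j - 2)%N; rewrite /grid subr0 natrB// natrD natrM -qi.
by field.
Qed.

(** The coefficient of index j reduces to that of t^(1 - j/2) in [Fp]: B(0) for j = 0, A(0) for j =
    2, and nothing for j = 1 (half-integral exponent) or j > 2 (negative exponent). *)
Lemma const_coef_ramified_poly :
  map_poly (@const_coef L) ramified_poly = A.[0] *: 'X^2 + B.[0]%:P.
Proof.
apply/polyP => j; rewrite coef_map_const_coef coef_ramified_poly.
rewrite sub0r coefD coefZ coefXn coefC !horner_coef0.
case: j => [|[|[|j]]] /=.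
- rewrite (_ : - _ + 1 = 1%:R) ?coef_family_poly_nat; last by rewrite mul0r oppr0 add0r.
  by rewrite F1E mulr0 add0r.
- rewrite mulr0 addr0; apply/eqP/negPn/negP => /family_poly_supported[i ei _].
  have : (2 * i)%:R = 1%:R :> rat by rewrite natrM -ei; field.
  by move/eqP; rewrite eqr_nat; case: i {ei} => // i; rewrite mulnS.
- rewrite (_ : - _ + 1 = 0%:R) ?coef_family_poly_nat; last by rewrite divff// addNr.
  by rewrite F0E coefXnM /= mulr1 addr0.
- rewrite mulr0 addr0; apply/eqP/negPn/negP => /family_poly_supported[i ei _].
  have : (2 * i + j.+3)%:R = 2%:R :> rat by rewrite natrD natrM -ei; field.
  by move/eqP; rewrite eqr_nat addnC.
Qed.

Lemma ramified_root b : b ^+ 2 = - B.[0] / A.[0] ->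
  exists x : P, [/\ order_ge (1 / 2%:R) x, x (1 / 2%:R) = b & root Fp x].
Proof.
move=> bE; have b0 : b != 0.
  by rewrite -sqrf_eq0 bE mulf_neq0 ?oppr_eq0 ?invr_neq0.
have [||y yS [yb yr]] := @hensel L 1 ramified_poly b ramified_poly_pseries.
- rewrite const_coef_ramified_poly /root hornerD hornerZ hornerXn hornerC.
  by rewrite bE mulrC divfK// addNr.
(* The root [b] is simple because 2 A(0) b is nonzero, which uses characteristic different from
   2. *)
- rewrite const_coef_ramified_poly derivD derivC addr0 derivZ derivXn.
  by rewrite hornerZ hornerMn hornerX -mulr_natl !mulf_neq0.
exists (monomial L (1 / 2%:R) * y); split.
- by rewrite -[1 / _]addr0; apply/order_ge_monomialM/(order_ge_pseries yS).
- by rewrite coef_monomialM subrr.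
- by rewrite /root horner_ramified_poly (eqP yr) mulr0.
Qed.

Lemma first_kind_t_roots : exists s1 s2 rs b,
  [/\ Fp = lead_coef Fp *: \prod_(z <- [:: s1, s2 & rs]) ('X - z%:P),
      perm_eq [:: s1, s2 & rs] (t_roots Fp),
      [/\ b ^+ 2 = - B.[0] / A.[0], order_ge (1 / 2%:R) s1,
        order_ge (1 / 2%:R) s2, s1 (1 / 2%:R) = b & s2 (1 / 2%:R) = - b],
      {subset rs <= pseries 0} &
      map (@const_coef L) rs = roots_of A].
Proof.
have [b bE] : exists b, b ^+ 2 = - B.[0] / A.[0].
  have [b] := @solve_monicpoly L 2 (fun i => if i is 0%N then - B.[0] / A.[0] else 0) isT.
  by rewrite !big_ord_recl big_ord0 /= !mul0r !addr0 mulr1 => bE; exists b.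
have b0 : b != 0 by rewrite -sqrf_eq0 bE mulf_neq0 ?oppr_eq0 ?invr_neq0.
have [s1 [s1o s1b s1r]] := ramified_root bE.
have [|s2 [s2o s2b s2r]] := @ramified_root (- b); first by rewrite sqrrN.
have [rs [rsS rsA rsr]] : exists rs : seq P,
    [/\ {subset rs <= pseries 0}, map (@const_coef L) rs = roots_of A
      & all (root Fp) rs].
  (* The trivial inclusion is generalized on its left side, so that the induction remembers that the
     elements of the shrinking list are roots of [A]. *)
  have : {subset roots_of A <= roots_of A} by [].
  elim: {1 3}(roots_of A) => [|a s IH] sA; first by exists [::].
  have [|rs [rsS rsA rsr]] := IH; first by move=> z zs; rewrite sA// inE zs orbT.
  have [|x [xS xa xr]] := @unramified_root a; first by rewrite sA// mem_head.
  exists (x :: rs); split => /=; last by rewrite xr.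
    by move=> z; rewrite inE => /predU1P[->//|/rsS].
  by rewrite rsA /const_coef xa.
have half : (0 < 1 / 2%:R :> rat) by [].
have not_rs s : order_ge (1 / 2%:R) s -> s \notin rs.
  move=> so; apply: contraNN A0 => /(map_f (@const_coef L)); rewrite rsA.
  by rewrite /const_coef so// mem_roots_of_A => /eqP->.
have s_uniq : uniq [:: s1, s2 & rs].
  (* The series in [rs] differ in their constant terms, the distinct roots of [A]; [s1] and [s2]
     differ because b = -b would give 2b = 0. *)
  rewrite /= inE negb_or !not_rs// !andbT; apply/andP; split; last first.
    by apply: (@map_uniq _ _ (@const_coef L)); rewrite rsA uniq_roots_of_A.
  apply: contraNneq b0 => e; have : b + b = 0 by rewrite -{1}s1b e s2b addNr.
  by rewrite -mulr2n -mulr_natl => /eqP; rewrite mulf_eq0 (negbTE two_neq0).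
have s_size : size Fp = (size [:: s1, s2 & rs]).+1.
  by rewrite size_family_poly -size_roots_of_A -rsA size_map.
have Fp_split : Fp = lead_coef Fp *: \prod_(z <- [:: s1, s2 & rs]) ('X - z%:P).
  by apply: idomain_all_roots => //=; rewrite s1r s2r.
exists s1, s2, rs, b; split => //.
apply: (perm_eq_split_roots _ s_uniq Fp_split).
  by rewrite -size_poly_eq0 size_family_poly.
(* [t_roots] is a choice with default value [[::]]; the splitting just found shows that the chosen
   list does split [Fp]. *)
apply: (@xgetPex _ [::] [set s | Fp = lead_coef Fp *: \prod_(z <- s) ('X - z%:P)]%classic).
by exists [:: s1, s2 & rs].
Qed.

End FirstKind.

(** * The formal discriminant for the factor x *)

Section Discriminant.
Variable L : closedFieldType.
Local Notation P := (puiseux L).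

Lemma roots_of_polyX : roots_of ('X : {poly L}) = [:: 0].
Proof.
have XE : 'X = lead_coef 'X *: \prod_(a <- roots_of ('X : {poly L})) ('X - a%:P).
  exact: svalP (closed_field_poly_normal 'X).
rewrite lead_coefX scale1r in XE.
case: (roots_of _) XE => [|a [|b s]] /= XE.
- by move/(congr1 (fun p : {poly L} => size p)): XE; rewrite size_polyX big_nil size_poly1.
- move: XE; rewrite big_seq1 => /(congr1 (fun p : {poly L} => - p.[0])).
  by rewrite hornerX hornerXsubC sub0r opprK oppr0 => <-.
- move/(congr1 (fun p : {poly L} => size p)): XE.
  by rewrite size_polyX size_prod_XsubC.
Qed.

Lemma Res_polyX (g : {poly L}) : Res 'X g = g.[0].
Proof. by rewrite /Res roots_of_polyX lead_coefX expr1n mul1r big_seq1. Qed.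

Lemma formal_disc1 (G : {poly P}) f : formal_disc G f 1 = 1.
Proof.
by rewrite /formal_disc expr0 mul1r big1// => i _; rewrite big1// => j; rewrite !ord1.
Qed.

Lemma pconst0 : pconst (0 : L) = 0.
Proof. by apply: puiseux_eq => q; rewrite pconstE; case: ifP. Qed.

Lemma pconst1 : pconst (1 : L) = 1. Proof. by []. Qed.

Lemma lowest_coef1 : lowest_coef (1 : P) = 1.
Proof.
rewrite (@lowest_coefE _ 0) -?pconst1 ?pconstE ?eqxx ?oner_neq0// => q q0.
by rewrite pconstE lt_eqF.
Qed.

Lemma lift_polyX : lift_poly ('X : {poly L}) = 'X.
Proof.
apply/polyP => i; rewrite coef_map_id0 ?pconst0// !coefX.
by case: eqP => _; rewrite ?pconst0 ?pconst1.
Qed.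

(** The list [disc_roots] is a choice, but for f = x its two entries p, q are constant in x with (x
    - p)(x - q) = (x - s1)(x - s2). So p + q and pq are determined, and with them (p - q)^2 = (p +
    q)^2 - 4pq. *)
Lemma formal_disc_polyX (G : {poly P}) s1 s2 rs
    (c := lead_coef G *: \prod_(z <- rs) ('X - z%:P)) :
  G != 0 -> G = lead_coef G *: \prod_(z <- [:: s1, s2 & rs]) ('X - z%:P) ->
  perm_eq [:: s1, s2 & rs] (t_roots G) ->
  s1 0 = 0 -> s2 0 = 0 -> {in rs, forall s : P, s 0 != 0} ->
  formal_disc G 'X 2 = c ^+ 2 * (s1 - s2)%:P ^+ 2.
Proof.
move=> G0 Gsplit Gperm s10 s20 rs0.
have lG0 : lead_coef G != 0 by rewrite lead_coef_eq0.
have cofE : disc_cofactor G 'X 2 = c.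
  rewrite /disc_cofactor lead_coefX expr1n invr1 pconst1 mul1r.
  congr (_ *: _); rewrite -(perm_big _ Gperm)/= !big_cons !hornerX s10 s20 eqxx /=.
  rewrite big_seq_cond [in RHS]big_seq; apply: eq_bigl => s.
  by rewrite hornerX; case: (boolP (s \in rs)) => // /rs0->.
have GE : G = c * (('X - s1%:P) * ('X - s2%:P)).
  by rewrite {1}Gsplit !big_cons mulrA mulrC scalerAl.
have c0 : c != 0 by apply: contraNneq G0 => c0; rewrite GE c0 mul0r.
have [szs' Gs' s'P] : is_disc_roots G 'X 2 (disc_roots G 'X 2).
  apply: (@xgetPex _ [::] [set s' | is_disc_roots G 'X 2 s']%classic).
  (* This witness rules out the default value [[::]] of [disc_roots]. *)
  exists [:: s1%:P; s2%:P]; split => //.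
    by rewrite cofE lift_polyX big_cons big_seq1.
  move=> p; rewrite !inE size_polyX => /orP[] /eqP->; split.
  - by rewrite ltnS size_polyC leq_b1.
  - by move=> j; rewrite coefC; case: eqP.
  - by rewrite ltnS size_polyC leq_b1.
  - by move=> j; rewrite coefC; case: eqP.
rewrite /formal_disc cofE; congr (_ * _).
move: szs' Gs' s'P; case: (disc_roots _ _ _) => [|p [|q [|]]]// _.
rewrite cofE lift_polyX big_cons big_seq1 => Gpq pqP.
rewrite 2!big_ord_recl big_ord0 mulr1 [X in _ * X]big1 => [|[[|[|j]] jP]]//.
rewrite mulr1 big_mkcond 2!big_ord_recl big_ord0 /= mul1r mulr1.
have /pqP[] : p \in [:: p; q] by rewrite mem_head.
rewrite size_polyX ltnS => /size1_polyC pE _.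
have /pqP[] : q \in [:: p; q] by rewrite !inE eqxx orbT.
rewrite size_polyX ltnS => /size1_polyC qE _.
have /(mulfI c0) : c * (('X - s1%:P) * ('X - s2%:P)) = c * (('X - p) * ('X - q)).
  by rewrite -GE.
rewrite pE qE -!polyCB => e.
(* Evaluation at 0 yields the product, and evaluation at 1 then yields the sum. *)
have e0 : p`_0 * q`_0 = s1 * s2.
  by move/(congr1 (fun r => r.[0])): e; rewrite !hornerE !mulrNN => ->.
have e1 : p`_0 + q`_0 = s1 + s2.
  move/(congr1 (fun r => r.[1])): e; rewrite !hornerE => e.
  have : (1 - s1) * (1 - s2) - (1 - p`_0) * (1 - q`_0) - s1 * s2 + p`_0 * q`_0 = 0.
    by rewrite e e0; ring.
  by move=> h; apply/eqP; rewrite -subr_eq0; apply/eqP; rewrite -[RHS]h; ring.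
rewrite -!polyC_exp; congr (_%:P).
have -> : (p`_0 - q`_0) ^+ 2 = (p`_0 + q`_0) ^+ 2 - (p`_0 * q`_0) *+ 4 by ring.
by rewrite e0 e1; ring.
Qed.

End Discriminant.

(** * The vertex over an algebraically closed field *)

Section VertexFirstKind.
Variables (L : closedFieldType) (n : nat) (F : nat -> {poly L}) (A B : {poly L}).
Local Notation P := (puiseux L).

Lemma vertex_first_kind : 2%:R != 0 :> L -> is_family n F ->
  F 0%N = 'X^2 * A -> F 1%N = B -> A.[0] != 0 -> B.[0] != 0 -> separable_poly A ->
  vertex n F [:: ('X, 2%N); (A, 1%N)] = - 4%:R * B.[0] * A.[0] ^+ 3.
Proof.
move=> two_neq0 F_family F0E F1E A0 B0 A_sep.
set Fp := family_poly n F.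
have [s1 [s2 [rs [b [split_Fp perm_Fp [bE s1o s2o s1b s2b] rsS rsA]]]]] :=
  first_kind_t_roots two_neq0 F_family F0E F1E A0 B0 A_sep.
have half : (0 < 1 / 2%:R :> rat) by [].
have Fp0 : Fp != 0 by rewrite -size_poly_eq0 (size_family_poly F_family).
have rs0 : {in rs, forall s : P, s 0 != 0}.
  move=> s /(map_f (@const_coef L)); rewrite rsA (mem_roots_of_A A0) => sA.
  by apply: contraTneq sA; rewrite /const_coef => ->.
have discE : (formal_disc Fp 'X 2).[pconst 0] =
    (lead_coef Fp * \prod_(z <- rs) - z) ^+ 2 * (s1 - s2) ^+ 2.
  rewrite (formal_disc_polyX Fp0 split_Fp) ?s1o ?s2o//.
  rewrite hornerM !horner_exp hornerC hornerZ horner_prod.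
  congr ((_ * _) ^+ 2 * _); apply: eq_bigr => z _.
  by rewrite hornerXsubC pconst0 sub0r.
set c := lead_coef Fp * _ in discE.
have leadS : lead_coef Fp \in pseries 0.
  by rewrite lead_coefE (polyOverP (family_poly_pseries F_family)).
have prodS : \prod_(z <- rs) - z \in pseries 0.
  by rewrite big_seq rpred_prod// => z /rsS zS; rewrite rpredN.
have c_order : order_ge 0 c by apply/(order_ge_pseries (N := 0)); rewrite rpredM.
(* At t = 0 the cofactor becomes the leading coefficient of [A] times the product of the negated
   roots of [A]. *)
have c_const : c 0 = A.[0].
  have AE : A = lead_coef A *: \prod_(a <- roots_of A) ('X - a%:P).
    exact: svalP (closed_field_poly_normal A).
  rewrite (const_coef_pseriesM leadS prodS) [in RHS]AE hornerZ -rsA big_map horner_prod.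
  rewrite (const_coef_lead_family_poly F_family F0E) (const_coef_pseries_prod (N := 0)).
    by congr (_ * _); apply: eq_bigr => z _; rewrite hornerXsubC sub0r.
  by move=> z /rsS zS; rewrite rpredN.
have d_order : order_ge (0 + 1 / 2%:R) (c * (s1 - s2)).
  exact/order_geM/order_geD/order_geN.
have d_coef : (c * (s1 - s2)) (0 + 1 / 2%:R) = A.[0] * (b *+ 2).
  rewrite (coef_mulp_lowest c_order (order_geD s1o (order_geN s2o))) c_const.
  by rewrite coef_addp /= s1b s2b opprK.
rewrite add0r in d_order d_coef.
have b0 : b != 0 by rewrite -sqrf_eq0 bE mulf_neq0 ?oppr_eq0 ?invr_neq0.
(* The discriminant is the square of [c * (s1 - s2)], whose lowest term is 2b A(0) t^(1/2); then b^2
   = -B(0)/A(0) is substituted. *)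
have discX : lowest_coef (formal_disc Fp 'X 2).[pconst 0] = - 4%:R * B.[0] * A.[0].
  rewrite discE -exprMn expr2.
  rewrite (lowest_coefE _ (order_geM d_order d_order)) (coef_mulp_lowest d_order d_order).
    rewrite d_coef.
    have -> : A.[0] * (b *+ 2) * (A.[0] * (b *+ 2)) = 4%:R * A.[0] ^+ 2 * b ^+ 2 by ring.
    by rewrite bE; field.
  by rewrite d_coef -mulr_natl !mulf_neq0.
rewrite /vertex /= !big_ord_recl !big_ord0 /= -/Fp roots_of_polyX big_seq1 discX.
rewrite formal_disc1 big1 ?mulr1 => [|a _]; last by rewrite hornerC lowest_coef1.
rewrite [X in _ * (_ * X)]big1 => [|[[|[|j]] jP]]//.
rewrite big_mkcond 2!big_ord_recl big_ord0 /= mul1r !mulr1 Res_polyX.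
(* The integer exponent 2(2 + 1 - 2) of the resultant computes to 2. *)
rewrite -[_ ^ _]/(A.[0] ^+ 2); ring.
Qed.

End VertexFirstKind.

(** * Square-free polynomials in characteristic zero *)

Lemma square_free_separable (K : fieldType) (p : {poly K}) :
  [pchar K] =i pred0 -> p != 0 -> square_free p -> separable_poly p.
Proof.
move=> /pcharf0P K0 p0 sqf; apply/separable_polyP; split=> [u v uvp|u _ u1].
  (* The square of gcd(u, v) divides uv, hence p, so the gcd is constant. *)
  have uv0 : u * v != 0 by apply: contraTneq uvp => ->; rewrite dvd0p.
  rewrite coprimep_def eqn_leq sqf ?size_poly_gt0 ?gcdp_eq0.
    by apply: contraNN uv0 => /andP[/eqP->]; rewrite mul0r.
  by apply: dvdp_trans uvp; rewrite expr2 dvdp_mul ?dvdp_gcdl ?dvdp_gcdr.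
(* The top coefficient of the derivative is deg(u) times the leading coefficient of u, nonzero in
   characteristic zero. *)
apply/eqP => /(congr1 (fun q : {poly K} => q`_(size u).-2)).
have -> : u^`()`_(size u).-2 = lead_coef u *+ (size u).-1.
  by rewrite coef_deriv lead_coefE; case: (size u) u1 => [|[]].
move/eqP; rewrite coef0 -mulr_natl mulf_eq0 K0 lead_coef_eq0 -size_poly_eq0.
by case: (size u) u1 => [|[]].
Qed.

(** * Transport along the embedding of A into the algebraic closure *)

Unset Implicit Arguments.

Theorem proposition3p2
    (k : closedFieldType) (char0 : [pchar k] =i pred0)
    (A : idomainType) (alg : {rmorphism k -> A})
    (Kbar : closedFieldType) (iota : {rmorphism {fraction A} -> Kbar})
    (Kbar_alg : forall z : Kbar, algebraicOver iota z)
    (n : nat) (F : nat -> {poly A}) (A_ B_ : {poly A}) :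
  first_kind n F A_ B_ ->
  Ver iota n F [:: ('X, 2%N); (A_, 1%N)] =
    frac_embed iota (- 4%:R * B_.[0] * A_.[0] ^+ 3).
Proof.
move=> [_ [F0_size F_size] [F0E F1E] _ [AB0 A_sqf]].
have K_char0 : [pchar {fraction A}] =i pred0.
  by move=> p; rewrite (fmorph_pchar (@FracField.tofrac A \o alg)) char0.
have Kbar_char0 : [pchar Kbar] =i pred0.
  by move=> p; rewrite (fmorph_pchar iota) K_char0.
pose e : {rmorphism A -> Kbar} := iota \o @FracField.tofrac A.
have e_inj : injective e.
  by move=> x y /fmorph_inj/eqP; rewrite tofrac_eq => /eqP.
have e_horner0 (p : {poly A}) : (map_poly e p).[0] = e p.[0].
  by rewrite -(rmorph0 e) horner_map.
have e_neq0 (p : {poly A}) : p.[0] != 0 -> (map_poly e p).[0] != 0.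
  by rewrite e_horner0 -(rmorph0 e) (inj_eq e_inj).
have e_size (p : {poly A}) : size (map_poly e p) = size p.
  by apply: size_map_inj_poly; rewrite ?rmorph0.
move: AB0; rewrite mulf_eq0 negb_or => /andP[A0 B0].
have A_neq0 : A_ != 0 by apply: contraNneq A0 => ->; rewrite horner0.
rewrite /Ver /= -[frac_embed iota]/(e : A -> Kbar) map_polyX.
rewrite (@vertex_first_kind _ _ _ _ (map_poly e B_)) ?e_neq0 ?F1E//.
- by rewrite !e_horner0 rmorphM rmorphXn rmorphM rmorphN rmorph_nat.
- by rewrite ((pcharf0P Kbar).1 Kbar_char0).
- by split => [|i]; rewrite e_size.
- by rewrite F0E rmorphM rmorphXn /= map_polyX.
(* Separability is preserved by field extensions, so it is checked over the fraction field, where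
   square-freeness is assumed. *)
rewrite map_poly_comp separable_map square_free_separable//.
apply: contraNneq A_neq0 => A_0.
by rewrite -size_poly_eq0 -e_size map_poly_comp A_0 rmorph0 size_poly0.
Qed.
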